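(* Let $E$ be a Banach space with an unconditional basis $(x_k)$ such that, for some $1\le p<\infty$, the sequence $(|\delta_{x_k}|)$ in $\mathrm{FBL}^{(p)}[E]$ is equivalent to the unit vector basis of $\ell_2$. Then $(x_k)$ is equivalent to the unit vector basis of $c_0$.
   Context: Banach spaces are real. For $1\le p<\infty$ and a Banach space $E$, $H[E]$ is the vector lattice (pointwise operations) of positively homogeneous functions $f:E^*\to\mathbb R$, with $\|f\|_{\mathrm{FBL}^{(p)}[E]}=\sup\{(\sum_{k=1}^n|f(x_k^* )|^p)^{1/p}: n\in\mathbb N,\ x_1^*,\dots,x_n^*\in E^*,\ \sup_{x\in B_E}\sum_{k=1}^n|x_k^*(x)|^p\le 1\}$. For $x\in E$ let $\delta_x(x^* )=x^*(x)$. $\mathrm{FBL}^{(p)}[E]$ is the closure, in the space of $f\in H[E]$ with finite norm, of the sublattice generated by $\{\delta_x:x\in E\}$. $|\delta_x|$ is the (pointwise) modulus. Two sequences $(u_k)$, $(v_k)$ in normed spaces are equivalent if there is $K\ge1$ with $K^{-1}\|\sum a_ku_k\|\le\|\sum a_kv_k\|\le K\|\sum a_ku_k\|$ for all finitely supported scalar sequences $(a_k)$. *)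

(* Defs.v *)
From HB Require Import structures.
From mathcomp Require Import all_boot all_order all_algebra.
From mathcomp Require Import ring lra.
From mathcomp Require Import all_classical all_reals all_analysis.

Set Implicit Arguments.
Unset Strict Implicit.
Unset Printing Implicit Defensive.

Import Order.TTheory GRing.Theory Num.Theory.
Import numFieldNormedType.Exports.

Local Open Scope classical_set_scope.
Local Open Scope ring_scope.

Section Dual.
Context {R : realType} {E : normedModType R}.

(* [dual E] is the space E^* of continuous linear functionals on E. *)
Definition dual_pred : {pred E -> R} :=
  fun f => `[< linear f /\ continuous f >].

Lemma dual_submod_closed : submod_closed dual_pred.
Proof.
split=> [|a f g /asboolP[lf cf] /asboolP[lg cg]]; apply/asboolP; split.
- by move=> a u v; rewrite [LHS]/= scaler0 addr0.
- exact: cst_continuous.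
- move=> b u v; rewrite !fctE lf lg /GRing.scale /=.
  by rewrite !mulrDr !mulrA (mulrC a b) addrACA.
- by move=> x; apply: cvgD; [apply: cvgZr; exact: cf | exact: cg].
Qed.

HB.instance Definition _ :=
  GRing.isSubmodClosed.Build R (E -> R) dual_pred dual_submod_closed.

End Dual.

Record dual {R : realType} (E : normedModType R) :=
  Dual { dual_val :> E -> R; dualP : dual_val \in dual_pred }.

Section DualInstances.
Context {R : realType} {E : normedModType R}.

HB.instance Definition _ := [isSub of dual E for @dual_val R E].
HB.instance Definition _ := [Choice of dual E by <:].
HB.instance Definition _ := [SubChoice_isSubLmodule of dual E by <:].

Lemma dual_linear (x' : dual E) : linear x'.
Proof. by have /asboolP[] := dualP x'. Qed.

Lemma dual_continuous (x' : dual E) : continuous x'.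
Proof. by have /asboolP[] := dualP x'. Qed.

Lemma dualDE (x' y' : dual E) x : (x' + y') x = x' x + y' x.
Proof. by []. Qed.

Lemma dualZE a (x' : dual E) x : (a *: x') x = a * x' x.
Proof. by []. Qed.

Lemma dual0r (x' : dual E) : x' 0 = 0.
Proof.
have := dual_linear x' 1 0 0; rewrite scaler0 addr0 scale1r.
by move/eqP; rewrite -subr_eq subrr eq_sym => /eqP.
Qed.

Lemma dualZr (x' : dual E) a x : x' (a *: x) = a * x' x.
Proof. by rewrite -[a *: x]addr0 dual_linear dual0r addr0. Qed.

Lemma dual_bounded (x' : dual E) :
  exists2 M : R, 0 < M & forall x, `|x' x| <= M * `|x|.
Proof.
pose f := HB.pack_for {linear E -> R} (x' : E -> R)
  (GRing.isLinear.Build _ _ _ _ (x' : E -> R) (dual_linear x')).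
have := @continuous_linear_bounded _ _ _ 0 f (@dual_continuous x' 0).
move=> /linear_boundedP[M [_ fM]].
exists (Num.max 1 (M + 1)); first by rewrite lt_max ltr01.
by apply: fM; rewrite lt_max (ltrDl M) ltr01 orbT.
Qed.

End DualInstances.

Section WeakBall.
Context {R : realType} {E : normedModType R}.

(* sup_{x in B_E} sum_k |xs_k(x)|^p <= 1 *)
Definition weak_lp_ball (p : R) n (xs : 'I_n -> dual E) : Prop :=
  (ereal_sup [set (\sum_(k < n) `|xs k x| `^ p)%:E | x in
      [set x : E | (`|x| <= 1)%R]] <= 1)%E.

End WeakBall.

(* Locked to prevent costly unification problems; use [FBLnormE]. *)
Fact FBLnorm_key : unit. Proof. by []. Qed.

Definition FBLnorm {R : realType} {E : normedModType R} (p : R) :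
    (dual E -> R) -> \bar R :=
  locked_with FBLnorm_key (fun f : dual E -> R =>
    ereal_sup [set e | exists n (xs : 'I_n -> dual E), weak_lp_ball p xs /\
      e = ((\sum_(k < n) `|f (xs k)| `^ p) `^ p^-1)%:E]).

Lemma FBLnormE {R : realType} {E : normedModType R} (p : R) (f : dual E -> R) :
  FBLnorm p f = ereal_sup [set e | exists n (xs : 'I_n -> dual E),
    weak_lp_ball p xs /\
    e = ((\sum_(k < n) `|f (xs k)| `^ p) `^ p^-1)%:E].
Proof. by rewrite /FBLnorm locked_withE. Qed.

Section VectorLattice.
Context {R : realType} {E : normedModType R}.
Implicit Types (f : dual E -> R).

Definition pos_homogeneous f : Prop :=
  forall (a : R) (x' : dual E), 0 <= a -> f (a *: x') = a * f x'.

Definition delta (x : E) : dual E -> R := fun x' => x' x.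

(* Linear sublattices are taken in the lattice of all functions on E^*.  As H[E]
   is a linear sublattice of it containing every [delta x], the sublattice
   generated by the [delta x] is the same as the one generated in H[E]. *)
Definition sublattice (A : set (dual E -> R)) : Prop :=
  [/\ A 0, forall (a : R) f g, A f -> A g -> A (a *: f + g),
      forall f g, A f -> A g -> A (f \max g)
    & forall f g, A f -> A g -> A (f \min g)].

Definition delta_sublattice : set (dual E -> R) :=
  smallest sublattice (range delta).

End VectorLattice.

Section FiniteNorm.
Context {R : realType} {E : normedModType R} {p : R}.
Hypothesis p1 : 1 <= p.
Implicit Types (f g : dual E -> R).

Let p_gt0 : 0 < p. Proof. exact: lt_le_trans p1. Qed.
Let p_ge0 : 0 <= p. Proof. exact: ltW. Qed.

Lemma FBLnorm_ge n (xs : 'I_n -> dual E) f : weak_lp_ball p xs ->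
  (((\sum_(k < n) `|f (xs k)| `^ p) `^ p^-1)%:E <= FBLnorm p f)%E.
Proof.
by rewrite FBLnormE => xs1; apply: ereal_sup_ubound; exists n, xs.
Qed.

Lemma FBLnorm_le f (c : R) : 0 <= c ->
  (forall n (xs : 'I_n -> dual E), weak_lp_ball p xs ->
    \sum_(k < n) `|f (xs k)| `^ p <= c `^ p) ->
  (FBLnorm p f <= c%:E)%E.
Proof.
move=> c0 h; rewrite FBLnormE; apply: ge_ereal_sup => _ [n [xs [xs1 ->]]].
rewrite lee_fin.
have -> : c = (c `^ p) `^ p^-1 by rewrite -powRrM mulfV ?gt_eqF// powRr1.
rewrite ge0_ler_powR ?nnegrE ?invr_ge0 ?powR_ge0 ?h//.
by apply: sumr_ge0 => i _; exact: powR_ge0.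
Qed.

Lemma FBLnorm_sum_le f (c : R) n (xs : 'I_n -> dual E) : 0 <= c ->
  (FBLnorm p f <= c%:E)%E -> weak_lp_ball p xs ->
  \sum_(k < n) `|f (xs k)| `^ p <= c `^ p.
Proof.
move=> c0 fc xs1; have := le_trans (FBLnorm_ge f xs1) fc; rewrite lee_fin.
set S := \sum_(k < n) _; have S0 : 0 <= S.
  by apply: sumr_ge0 => i _; exact: powR_ge0.
move=> h; have -> : S = (S `^ p^-1) `^ p.
  by rewrite -powRrM mulVf ?gt_eqF// powRr1.
by rewrite ge0_ler_powR ?nnegrE ?powR_ge0.
Qed.

Lemma FBLnorm_ge0 f : (0 <= FBLnorm p f)%E.
Proof.
have h : weak_lp_ball p (fun _ : 'I_0 => (0 : dual E)).
  by apply: ge_ereal_sup => _ [x _ <-]; rewrite big_ord0 lee_fin.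
by apply: le_trans (FBLnorm_ge f h); rewrite lee_fin powR_ge0.
Qed.

Lemma minkowski_finite n (a b : 'I_n -> R) (A B : R) : 0 < A -> 0 < B ->
  \sum_(k < n) `|a k| `^ p <= A `^ p -> \sum_(k < n) `|b k| `^ p <= B `^ p ->
  \sum_(k < n) `|a k + b k| `^ p <= (A + B) `^ p.
Proof.
move=> A0 B0 hA hB; have AB0 : 0 < A + B by rewrite addr_gt0.
pose t := A / (A + B).
have t0 : 0 <= t by rewrite divr_ge0 ?(ltW A0) ?(ltW AB0).
have t1 : t <= 1 by rewrite ler_pdivrMr// mul1r lerDl ltW.
have quotE (x C : R) : 0 < C -> 0 <= x -> x `^ p / C `^ p = (x / C) `^ p.
  move=> C0 x0; have {1}-> : x = x / C * C by rewrite divfK ?gt_eqF.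
  by rewrite powRM ?divr_ge0 ?(ltW C0)// mulfK ?gt_eqF ?powR_gt0.
have ptw k : `|a k + b k| `^ p <= (A + B) `^ p *
    (t * (`|a k| `^ p / A `^ p) + (1 - t) * (`|b k| `^ p / B `^ p)).
  rewrite mulrC -ler_pdivrMr ?powR_gt0// !quotE//.
  have c : (t * (`|a k| / A) + (1 - t) * (`|b k| / B)) `^ p <=
      t * (`|a k| / A) `^ p + (1 - t) * (`|b k| / B) `^ p.
    apply: (convex_powR p1 (Itv01 t0 t1)) => //=;
      by rewrite inE/= in_itv/= andbT divr_ge0// ltW.
  apply: le_trans c.
  have <- : (`|a k| + `|b k|) / (A + B) =
      t * (`|a k| / A) + (1 - t) * (`|b k| / B).
    by rewrite /t; field; rewrite !gt_eqF.
  rewrite ge0_ler_powR ?nnegrE ?divr_ge0 ?addr_ge0 ?(ltW A0) ?(ltW B0)//.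
  rewrite ler_pM2r ?invr_gt0//; exact: ler_normD.
apply: (le_trans (ler_sum _ (fun k _ => ptw k))).
rewrite -mulr_sumr ger_pMr ?powR_gt0// big_split/= -!mulr_sumr -!mulr_suml.
apply: (@le_trans _ _ (t * 1 + (1 - t) * 1)); last first.
  by rewrite !mulr1 addrC subrK.
by rewrite lerD// ler_wpM2l ?subr_ge0// ler_pdivrMr ?powR_gt0// mul1r.
Qed.

Lemma FBLnormD f g :
  (FBLnorm p (fun x' => (f x' + g x')%R) <= FBLnorm p f + FBLnorm p g)%E.
Proof.
have := FBLnorm_ge0 f; have := FBLnorm_ge0 g.
case Eg : (FBLnorm p g) => [b| |]; last by rewrite leeNy_eq.
  case Ef : (FBLnorm p f) => [a| |]; last by rewrite leeNy_eq.
    rewrite !lee_fin => b0 a0; apply/lee_addgt0Pr => e e0.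
    have e2 : 0 < e / 2 by rewrite divr_gt0.
    have A0 : 0 < a + e / 2 by rewrite ltr_wpDl.
    have B0 : 0 < b + e / 2 by rewrite ltr_wpDl.
    rewrite -!EFinD; have -> : a + b + e = (a + e / 2) + (b + e / 2) by lra.
    apply: FBLnorm_le => [|n xs xs1]; first by rewrite addr_ge0 ?ltW.
    apply: minkowski_finite => //; apply: FBLnorm_sum_le => //;
      rewrite ?(ltW A0) ?(ltW B0)//.
      by rewrite Ef lee_fin lerDl ltW.
    by rewrite Eg lee_fin lerDl ltW.
  by rewrite addye ?leey.
by move=> _ f0; rewrite addey ?leey// -ltNye (lt_le_trans _ f0).
Qed.

Lemma FBLnormZ_le (a c : R) f : 0 <= c -> (FBLnorm p f <= c%:E)%E ->
  (FBLnorm p (fun x' => (a * f x')%R) <= (`|a| * c)%:E)%E.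
Proof.
move=> c0 fc; apply: FBLnorm_le => [|n xs xs1]; first by rewrite mulr_ge0.
rewrite powRM//; under eq_bigr do rewrite normrM powRM//.
by rewrite -mulr_sumr ler_wpM2l ?powR_ge0// FBLnorm_sum_le.
Qed.


Lemma FBLnorm_eq0 f : pos_homogeneous f -> FBLnorm p f = 0%E -> f = 0.
Proof.
move=> hf f0; apply/funext => x'; rewrite [RHS]/=.
have [M M0 xM] := dual_bounded x'.
have h : weak_lp_ball p (fun _ : 'I_1 => M^-1 *: x').
  apply: ge_ereal_sup => _ [x x1 <-]; rewrite lee_fin big_ord1 dualZE.
  have -> : 1 = 1 `^ p by rewrite powR1.
  rewrite ge0_ler_powR ?nnegrE// normrM gtr0_norm ?invr_gt0//.
  by rewrite mulrC ler_pdivrMr// mul1r (le_trans (xM x))// ger_pMr.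
have f0' : (FBLnorm p f <= 0%:E)%E by rewrite f0.
have := FBLnorm_sum_le (lexx 0) f0' h.
rewrite big_ord1 hf ?invr_ge0 ?(ltW M0)// powR0 ?gt_eqF// => h0.
have : `|M^-1 * f x'| `^ p = 0 by apply/eqP; rewrite eq_le h0 powR_ge0.
move/powR_eq0_eq0 => /eqP; rewrite normr_eq0 mulf_eq0 invr_eq0 gt_eqF//=.
by move/eqP.
Qed.

Lemma FBLnorm_absdelta (x : E) :
  (FBLnorm p (fun x' : dual E => `|delta x x'|%R) <= `|x|%:E)%E.
Proof.
apply: FBLnorm_le => // n xs xs1; rewrite /delta.
have [->|x0] := eqVneq x 0.
  rewrite normr0 powR0 ?gt_eqF// big1// => k _.
  by rewrite dual0r !normr0 powR0 ?gt_eqF.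
have nx0 : 0 < `|x| by rewrite normr_gt0.
pose y := `|x|^-1 *: x.
have y1 : `|y| <= 1 by rewrite normrZ normfV normr_id mulVf ?gt_eqF.
have : ((\sum_(k < n) `|xs k y| `^ p)%:E <= 1%:E)%E.
  by apply: le_trans xs1; apply: ereal_sup_ubound; exists y.
rewrite lee_fin -(ler_pM2l (powR_gt0 p nx0)) mulr1 mulr_sumr; apply: le_trans.
apply: ler_sum => k _; rewrite normr_id.
have -> : xs k y = `|x|^-1 * xs k x.
  exact: dualZr.
by rewrite -powRM// normrM normfV normr_id mulrA divff ?mul1r ?gt_eqF.
Qed.

End FiniteNorm.

Section FiniteNormSpace.
Context {R : realType} {E : normedModType R} {p : R}.

(* The proof [p1] is not used in the predicate: it is a parameter so that the
   subspace and normed-space structures below, which require [1 <= p], can be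
   inferred. *)
Definition Hfin_pred (p1 : 1 <= p) : {pred dual E -> R} :=
  fun f => `[< pos_homogeneous f /\ (FBLnorm p f < +oo)%E >].

Lemma Hfin_submod_closed (p1 : 1 <= p) : submod_closed (Hfin_pred p1).
Proof.
split=> [|a f g /asboolP[hf nf] /asboolP[hg ng]]; apply/asboolP; split.
- by move=> a x' _; rewrite /= mulr0.
- apply: le_lt_trans (ltry 0); apply: (FBLnorm_le p1) => // n xs _.
  rewrite big1 ?powR_ge0// => k _.
  by rewrite normr0 powR0// gt_eqF// (lt_le_trans _ p1).
- by move=> b x' b0; rewrite !fctE hf// hg// /GRing.scale/= mulrDr mulrCA.
- have -> : a *: f + g = (fun x' => a * f x' + g x') by apply/funext.
  apply: (le_lt_trans (FBLnormD p1 (fun x' => a * f x') g)).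
  apply: lte_add_pinfty; last exact: ng.
  have ff : FBLnorm p f \is a fin_num.
    by rewrite ge0_fin_numE// FBLnorm_ge0.
  apply: le_lt_trans (ltry (`|a| * fine (FBLnorm p f))).
  by apply: (FBLnormZ_le p1); rewrite ?fine_ge0 ?FBLnorm_ge0 ?fineK.
Qed.

HB.instance Definition _ (p1 : 1 <= p) :=
  GRing.isSubmodClosed.Build R (dual E -> R) (Hfin_pred p1)
    (Hfin_submod_closed p1).

End FiniteNormSpace.

(* [Hfin E p1] is the space of those f in H[E] with finite FBL^(p)-norm. *)
Record Hfin {R : realType} (E : normedModType R) (p : R) (p1 : 1 <= p) :=
  MkHfin { Hfin_val :> dual E -> R; HfinP : Hfin_val \in Hfin_pred p1 }.

Section HfinInstances.
Context {R : realType} {E : normedModType R} {p : R} {p1 : 1 <= p}.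

HB.instance Definition _ := [isSub of Hfin E p1 for @Hfin_val R E p p1].
HB.instance Definition _ := [Choice of Hfin E p1 by <:].
HB.instance Definition _ := [SubChoice_isSubLmodule of Hfin E p1 by <:].

Implicit Types f g : Hfin E p1.

Definition Hfin_norm f : R := fine (FBLnorm p f).

Lemma Hfin_normE f : (Hfin_norm f)%:E = FBLnorm p f.
Proof.
by have /asboolP[_ nf] := HfinP f; rewrite fineK// ge0_fin_numE// FBLnorm_ge0.
Qed.

Lemma Hfin_norm_ge0 f : 0 <= Hfin_norm f.
Proof. by rewrite fine_ge0// FBLnorm_ge0. Qed.

Lemma Hfin_normD f g : Hfin_norm (f + g) <= Hfin_norm f + Hfin_norm g.
Proof. by rewrite -lee_fin EFinD !Hfin_normE; exact: (FBLnormD p1). Qed.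

Lemma Hfin_normZ (a : R) f : Hfin_norm (a *: f) = `|a| * Hfin_norm f.
Proof.
have le b h : Hfin_norm (b *: h) <= `|b| * Hfin_norm h.
  have hh : (FBLnorm p h <= (Hfin_norm h)%:E)%E by rewrite Hfin_normE.
  rewrite -lee_fin Hfin_normE.
  exact: (FBLnormZ_le p1 b (Hfin_norm_ge0 h) hh).
apply/eqP; rewrite eq_le le/=; have [->|a0] := eqVneq a 0.
  by rewrite normr0 mul0r Hfin_norm_ge0.
have := le a^-1 (a *: f); rewrite scalerA mulVf// scale1r normfV.
by rewrite mulrC ler_pdivlMr ?normr_gt0// mulrC.
Qed.

Lemma Hfin_norm_eq0 f : Hfin_norm f = 0 -> f = 0.
Proof.
move=> f0; apply/val_inj; have /asboolP[hf _] := HfinP f.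
by apply: (FBLnorm_eq0 p1 hf); rewrite -Hfin_normE f0.
Qed.

HB.instance Definition _ := Lmodule_isNormed.Build R (Hfin E p1)
  Hfin_normD Hfin_normZ Hfin_norm_eq0.

End HfinInstances.

Section FBLSpace.
Context {R : realType} {E : normedModType R} {p : R}.

Definition FBL_pred (p1 : 1 <= p) : {pred Hfin E p1} :=
  fun f => `[< closure [set g : Hfin E p1 |
                          delta_sublattice (g : dual E -> R)] f >].
Arguments FBL_pred : clear implicits.

Lemma delta_sublatticeP : sublattice (@delta_sublattice R E).
Proof.
split.
- by move=> A [[]].
- move=> a f g hf hg A [sA dA]; case: (sA) => _ lA _ _.
  by apply: lA; [apply: hf | apply: hg].
- move=> f g hf hg A [sA dA]; case: (sA) => _ _ lA _.
  by apply: lA; [apply: hf | apply: hg].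
- move=> f g hf hg A [sA dA]; case: (sA) => _ _ _ lA.
  by apply: lA; [apply: hf | apply: hg].
Qed.

Lemma closure_normP (V : normedModType R) (A : set V) (v : V) :
  closure A v <-> forall e : R, 0 < e -> exists2 w, A w & `|v - w| < e.
Proof.
split=> [cA e e0|h B].
  have [w [Aw vw]] := cA _ (nbhsx_ballx v e e0).
  by exists w => //; rewrite -ball_normE in vw.
move=> /nbhs_ballP[e /= e0 eB]; have [w Aw vw] := h e e0.
by exists w; split=> //; apply: eB; rewrite -ball_normE.
Qed.

Lemma FBL_submod_closed (p1 : 1 <= p) : submod_closed (FBL_pred p1).
Proof.
have [s0 sl _ _] := delta_sublatticeP.
split=> [|a f g /asboolP/closure_normP hf /asboolP/closure_normP hg].
  by apply/asboolP; apply: subset_closure.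
apply/asboolP/closure_normP => e e0.
have e1 : 0 < e / 2 / (`|a| + 1) by rewrite !divr_gt0// ltr_wpDl.
have e2 : 0 < e / 2 by rewrite divr_gt0.
have [f' Af' ff'] := hf _ e1; have [g' Ag' gg'] := hg _ e2.
exists (a *: f' + g'); first exact: (sl a f' g' Af' Ag').
rewrite opprD addrACA -scalerBr [ltRHS]splitr.
rewrite (le_lt_trans (ler_normD _ _))// ler_ltD// normrZ.
rewrite (@le_trans _ _ ((`|a| + 1) * `|f - f'|)) ?ler_wpM2r ?lerDl//.
by move: ff'; rewrite ltr_pdivlMr ?ltr_wpDl// mulrC => /ltW.
Qed.

HB.instance Definition _ (p1 : 1 <= p) :=
  GRing.isSubmodClosed.Build R (Hfin E p1) (FBL_pred p1)
    (FBL_submod_closed p1).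

End FBLSpace.

Arguments FBL_pred {R E p} p1 _.

Record FBL {R : realType} (E : normedModType R) (p : R) (p1 : 1 <= p) :=
  MkFBL { FBL_val :> Hfin E p1; FBLP : FBL_val \in FBL_pred p1 }.

Section FBLInstances.
Context {R : realType} {E : normedModType R} {p : R} {p1 : 1 <= p}.

HB.instance Definition _ := [isSub of FBL E p1 for @FBL_val R E p p1].
HB.instance Definition _ := [Choice of FBL E p1 by <:].
HB.instance Definition _ := [SubChoice_isSubLmodule of FBL E p1 by <:].

Definition FBL_norm (f : FBL E p1) : R := `|f : Hfin E p1|.

Lemma FBL_normD f g : FBL_norm (f + g) <= FBL_norm f + FBL_norm g.
Proof. exact: ler_normD. Qed.

Lemma FBL_normZ (a : R) f : FBL_norm (a *: f) = `|a| * FBL_norm f.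
Proof. exact: normrZ. Qed.

Lemma FBL_norm_eq0 f : FBL_norm f = 0 -> f = 0.
Proof. by move=> /normr0_eq0 f0; apply/val_inj. Qed.

HB.instance Definition _ := Lmodule_isNormed.Build R (FBL E p1)
  FBL_normD FBL_normZ FBL_norm_eq0.

Lemma FBL_normE (f : FBL E p1) : `|f|%:E = FBLnorm p (f : dual E -> R).
Proof. exact: Hfin_normE. Qed.

End FBLInstances.

Section AbsDelta.
Context {R : realType} {E : normedModType R} {p : R} (p1 : 1 <= p) (x : E).

Lemma absdelta_Hfin : (fun x' => `|delta x x'|) \in Hfin_pred p1.
Proof.
apply/asboolP; split.
  by move=> a x' a0; rewrite /delta dualZE normrM ger0_norm.
exact: le_lt_trans (FBLnorm_absdelta p1 x) (ltry _).
Qed.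

Lemma absdelta_FBL : MkHfin absdelta_Hfin \in FBL_pred p1.
Proof.
apply/asboolP; apply: subset_closure => /=.
have [s0 sl sM _] := @delta_sublatticeP R E.
have dx : delta_sublattice (delta x) by move=> A [_]; apply; exists x.
have -> : (fun x' => `|delta x x'|) = delta x \max ((-1) *: delta x + 0).
  apply/funext => x'.
  rewrite -[RHS]/(Num.max (delta x x') (-1 * delta x x' + 0)).
  by rewrite mulN1r addr0 maxrN.
by apply: sM => //; exact: sl.
Qed.

Definition absdelta : FBL E p1 := MkFBL absdelta_FBL.

Lemma absdeltaE x' : absdelta x' = `|x' x|.
Proof. by []. Qed.

End AbsDelta.

Section Ell2.
Context {R : realType}.

Definition ell2_pred : {pred nat -> R} :=
  fun a => `[< cvgn (series (fun k => a k ^+ 2)) >].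

Lemma ell2_submod_closed : submod_closed ell2_pred.
Proof.
split=> [|c a b /asboolP ca /asboolP cb]; apply/asboolP.
  rewrite (_ : (fun k => _) = cst 0); last first.
    by apply/funext => k; rewrite /= expr0n.
  rewrite (_ : series _ = cst 0); first exact: is_cvg_cst.
  by apply/funext => n; rewrite /series/= big1.
apply: (@series_le_cvg _ _ (fun k => 2 * c ^+ 2 * a k ^+ 2 + 2 * b k ^+ 2)).
- by move=> k; exact: sqr_ge0.
- move=> k; apply: addr_ge0; last by rewrite mulr_ge0 ?sqr_ge0.
  by rewrite -mulrA mulr_ge0// mulr_ge0 ?sqr_ge0.
- move=> k; rewrite !fctE /GRing.scale/= -subr_ge0.
  have -> : 2 * c ^+ 2 * a k ^+ 2 + 2 * b k ^+ 2 - (c * a k + b k) ^+ 2 =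
    (c * a k - b k) ^+ 2 by ring.
  exact: sqr_ge0.
- have := is_cvg_seriesD (@is_cvg_seriesZ _ _ (2 * c ^+ 2) ca)
    (@is_cvg_seriesZ _ _ 2 cb).
  by congr (cvgn (series _)); apply/funext.
Qed.

HB.instance Definition _ :=
  GRing.isSubmodClosed.Build R (nat -> R) ell2_pred ell2_submod_closed.

End Ell2.

Record ell2 (R : realType) :=
  MkEll2 { ell2_val :> nat -> R; ell2P : ell2_val \in ell2_pred }.

Section Ell2Instances.
Context {R : realType}.

HB.instance Definition _ := [isSub of ell2 R for @ell2_val R].
HB.instance Definition _ := [Choice of ell2 R by <:].
HB.instance Definition _ := [SubChoice_isSubLmodule of ell2 R by <:].

Implicit Types a b : ell2 R.

Definition ell2_norm a : R := Num.sqrt (limn (series (fun k => a k ^+ 2))).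

Lemma ell2_cvg a : cvgn (series (fun k => a k ^+ 2)).
Proof. by have /asboolP := ell2P a. Qed.

Lemma ell2_partial_le a n :
  series (fun k => a k ^+ 2) n <= limn (series (fun k => a k ^+ 2)).
Proof.
have nd : nondecreasing_seq (series (fun k => a k ^+ 2)).
  by apply: nondecreasing_series => k _ _; exact: sqr_ge0.
exact: (nondecreasing_cvgn_le nd (@ell2_cvg a)) n.
Qed.

Lemma ell2_lim_ge0 a : 0 <= limn (series (fun k => a k ^+ 2)).
Proof. by apply: le_trans (ell2_partial_le a 0); rewrite /series/= big_geq. Qed.

Lemma ell2_normD a b : ell2_norm (a + b) <= ell2_norm a + ell2_norm b.
Proof.
apply/ler_addgt0Pr => e e0.
have e2 : 0 < e / 2 by rewrite divr_gt0.
pose A := ell2_norm a + e / 2; pose B := ell2_norm b + e / 2.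
have A0 : 0 < A by rewrite ltr_wpDl ?sqrtr_ge0.
have B0 : 0 < B by rewrite ltr_wpDl ?sqrtr_ge0.
have -> : ell2_norm a + ell2_norm b + e = A + B by rewrite /A /B; lra.
have AB0 : 0 <= A + B by rewrite addr_ge0// ltW.
rewrite -[leRHS]ger0_norm// -sqrtr_sqr ler_sqrt ?sqr_ge0//.
have part (d : ell2 R) n :
    \sum_(k < n) `|d k| `^ 2 <= (ell2_norm d + e / 2) `^ 2.
  rewrite powR_mulrn; last by rewrite addr_ge0 ?sqrtr_ge0 ?(ltW e2).
  under eq_bigr do rewrite powR_mulrn// real_normK ?num_real//.
  have := ell2_partial_le d n; rewrite /series/= big_mkord. move=> /le_trans; apply.
  rewrite -[leLHS]sqr_sqrtr ?ell2_lim_ge0//.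
  by rewrite lerXn2r ?nnegrE ?addr_ge0 ?sqrtr_ge0 ?(ltW e2)// lerDl ltW.
apply: limr_le; first exact: (@ell2_cvg (a + b)).
apply: nearW => n; rewrite /series/= big_mkord.
have := minkowski_finite (ler1n _ 2) A0 B0 (part a n) (part b n).
rewrite powR_mulrn//; under eq_bigr do rewrite powR_mulrn// real_normK ?num_real//.
by [].
Qed.

Lemma ell2_normZ (c : R) a : ell2_norm (c *: a) = `|c| * ell2_norm a.
Proof.
rewrite /ell2_norm -sqrtr_sqr -sqrtrM ?sqr_ge0//; congr Num.sqrt.
rewrite -[_ * _]/(c ^+ 2 *: (_ : R^o)) -lim_seriesZ; last exact: ell2_cvg.
congr (limn (series _)); apply/funext => k.
by rewrite !fctE /GRing.scale/= exprMn.
Qed.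

Lemma ell2_norm_eq0 a : ell2_norm a = 0 -> a = 0.
Proof.
move=> /eqP; rewrite sqrtr_eq0 => a0; apply/val_inj/funext => k /=.
have := le_trans (ell2_partial_le a k.+1) a0.
rewrite /series/= big_nat_recr//= => h; apply/eqP; rewrite -sqrf_eq0.
rewrite eq_le sqr_ge0 andbT; apply: le_trans h; rewrite lerDr.
by apply: sumr_ge0 => i _; exact: sqr_ge0.
Qed.

HB.instance Definition _ := Lmodule_isNormed.Build R (ell2 R)
  ell2_normD ell2_normZ ell2_norm_eq0.

End Ell2Instances.

Section C0.
Context {R : realType}.

Definition c0_pred : {pred nat -> R} := fun a => `[< a @ \oo --> (0 : R) >].

Lemma c0_submod_closed : submod_closed c0_pred.
Proof.
split=> [|c a b /asboolP ca /asboolP cb]; apply/asboolP; first exact: cvg_cst.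
by rewrite -[X in _ --> X]addr0 -[X in _ --> X + _](scaler0 _ c);
  apply: cvgD => //; exact: cvgZr.
Qed.

HB.instance Definition _ :=
  GRing.isSubmodClosed.Build R (nat -> R) c0_pred c0_submod_closed.

End C0.

Record c0 (R : realType) :=
  MkC0 { c0_val :> nat -> R; c0P : c0_val \in c0_pred }.

Section C0Instances.
Context {R : realType}.

HB.instance Definition _ := [isSub of c0 R for @c0_val R].
HB.instance Definition _ := [Choice of c0 R by <:].
HB.instance Definition _ := [SubChoice_isSubLmodule of c0 R by <:].

Implicit Types a b : c0 R.

Definition c0_norm a : R := sup (range (fun k => `|a k|)).

Lemma c0_has_sup a : has_sup (range (fun k => `|a k|)).
Proof.
split; first by exists `|a 0|, 0.
have /asboolP/cvgP/cvg_seq_bounded[M [_ aM]] := c0P a.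
by exists (M + 1) => _ [k _ <-]; apply: aM => //; rewrite ltrDl.
Qed.

Lemma c0_norm_ge a k : `|a k| <= c0_norm a.
Proof. by apply: ub_le_sup; [case: (c0_has_sup a) | exists k]. Qed.

Lemma c0_norm_le a (M : R) : (forall k, `|a k| <= M) -> c0_norm a <= M.
Proof.
move=> aM; apply: ge_sup; first by case: (c0_has_sup a).
by move=> _ [k _ <-].
Qed.

Lemma c0_normD a b : c0_norm (a + b) <= c0_norm a + c0_norm b.
Proof.
apply: c0_norm_le => k; apply: le_trans (ler_normD _ _) _.
by rewrite lerD ?c0_norm_ge.
Qed.

Lemma c0_normZ (c : R) a : c0_norm (c *: a) = `|c| * c0_norm a.
Proof.
have le d b : c0_norm (d *: b) <= `|d| * c0_norm b.
  by apply: c0_norm_le => k; rewrite normrM ler_wpM2l ?c0_norm_ge.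
apply/eqP; rewrite eq_le le/=; have [->|c_neq0] := eqVneq c 0.
  by rewrite normr0 mul0r (le_trans _ (c0_norm_ge _ 0)).
have := le c^-1 (c *: a); rewrite scalerA mulVf// scale1r normfV.
by rewrite mulrC ler_pdivlMr ?normr_gt0// mulrC.
Qed.

Lemma c0_norm_eq0 a : c0_norm a = 0 -> a = 0.
Proof.
move=> a0; apply/val_inj/funext => k /=; apply/normr0_eq0/eqP.
by rewrite eq_le normr_ge0 andbT -a0 c0_norm_ge.
Qed.

HB.instance Definition _ := Lmodule_isNormed.Build R (c0 R)
  c0_normD c0_normZ c0_norm_eq0.

End C0Instances.

Section UnitVectors.
Context (R : realType) (k : nat).

Let e : nat -> R := fun j => (j == k)%:R.

Lemma unit_vector_ell2 : e \in ell2_pred.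
Proof.
apply/asboolP; apply/cvg_ex; exists 1.
apply: cvg_near_cst; near=> n.
have kn : (k < n)%N by near: n; exact: nbhs_infty_gt.
rewrite /series/= big_mkord (bigD1 (Ordinal kn))//= /e eqxx expr1n big1 ?addr0//.
by move=> i /negbTE; rewrite -val_eqE/= => ->; rewrite expr0n.
Unshelve. all: by end_near. Qed.

Lemma unit_vector_c0 : e \in c0_pred.
Proof.
apply/asboolP; apply: cvg_near_cst; near=> n.
have kn : (k < n)%N by near: n; exact: nbhs_infty_gt.
by rewrite /e gtn_eqF.
Unshelve. all: by end_near. Qed.

Definition ell2_unit : ell2 R := MkEll2 unit_vector_ell2.
Definition c0_unit : c0 R := MkC0 unit_vector_c0.

End UnitVectors.

Definition schauder_basis (R : realType) (E : normedModType R)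
    (x : nat -> E) : Prop :=
  forall v : E, exists! a : nat -> R, series (fun k => a k *: x k) @ \oo --> v.

Definition unconditionally_cvg (R : realType) (E : normedModType R)
    (u : nat -> E) : Prop :=
  forall s : nat -> nat, bijective s -> cvgn (series (u \o s)).

Definition unconditional_basis (R : realType) (E : normedModType R)
    (x : nat -> E) : Prop :=
  schauder_basis x /\
  forall a : nat -> R, cvgn (series (fun k => a k *: x k)) ->
    unconditionally_cvg (fun k => a k *: x k).

(* Every finitely supported scalar sequence is given by its first n terms, for
   some n; the values of [a] at indices k >= n do not occur. *)
Definition equivalent_seq (R : realType) (U V : normedModType R)
    (u : nat -> U) (v : nat -> V) : Prop :=
  exists2 K : R, 1 <= K & forall (n : nat) (a : nat -> R),
    K^-1 * `|\sum_(k < n) a k *: u k| <= `|\sum_(k < n) a k *: v k|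
      <= K * `|\sum_(k < n) a k *: u k|.

(* Main.v *)
(* Testing the norm of sum_k b_k |delta_{x_k}| (b_k >= 0) against the functionals
   sum_k +-b_k x_k^*, over all choices of signs, and using Khintchine's
   inequality, the upper 2-estimate of (|delta_{x_k}|) gives
     sum_k b_k^2 <= const * sup_{v in B_E} sum_k b_k^2 x_k^*(v)^2.
   The lower 2-estimate bounds |x_k| from below, so the x_k^* are uniformly
   bounded and x_k^*(v)^2 <= const * |x_k^*(v)| on B_E.  With w_k = b_k^2 the right
   side is then at most const * sup_v sum_k w_k |x_k^*(v)|, that is, the norm of
   sum_k w_k x_k^* up to the unconditionality constant.  Hence the x_k^* dominate
   the unit vector basis of l_1, and by duality (x_k) is dominated by that of c_0;
   the converse domination is the boundedness of the x_k^*. *)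
Require Import Defs.
From HB Require Import structures.
From mathcomp Require Import all_boot all_order all_algebra.
From mathcomp Require Import ring lra.
From mathcomp Require Import all_classical all_reals all_analysis.

Set Implicit Arguments.
Unset Strict Implicit.
Unset Printing Implicit Defensive.

Import Order.TTheory GRing.Theory Num.Theory.
Import numFieldNormedType.Exports.

Local Open Scope classical_set_scope.
Local Open Scope ring_scope.

(** * Unconditional bases *)

(** The permutation reads entry [k] off [L k.+1], which is long enough since sizes grow strictly;
    entries never change along the chain. It is injective because the lists are duplicate-free and
    onto because [k] occurs in [L k.+1]. *)
Lemma chain_permutation (L : nat -> seq nat) :
  (forall i, prefix (L i) (L i.+1) /\ (size (L i) < size (L i.+1))%N) ->
  (forall i, perm_eq (L i) (iota 0 (size (L i)))) ->
  exists2 s : nat -> nat, bijective s &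
    forall i Y, prefix Y (L i) -> [seq s k | k <- iota 0 (size Y)] = Y.
Proof.
move=> chain_L perm_L.
have size_L i : (i <= size (L i))%N.
  by elim: i => // i IH; apply: leq_ltn_trans IH (chain_L i).2.
have prefix_L i j : (i <= j)%N -> prefix (L i) (L j).
  move=> /subnKC <-; elim: (j - i)%N => [|d IH]; first by rewrite addn0 prefix_refl.
  by rewrite addnS; apply: prefix_trans IH (chain_L _).1.
have nth_prefix (X Y : seq nat) k : prefix X Y -> (k < size X)%N -> nth 0%N Y k = nth 0%N X k.
  by move=> /prefixP[Z ->] kX; rewrite nth_cat kX.
pose s k := nth 0%N (L k.+1) k.
have sE i k : (k < size (L i))%N -> s k = nth 0%N (L i) k.
  move=> ki; rewrite /s; have [/prefix_L ik|/ltnW/prefix_L ik] := leqP i k.+1.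
    exact: nth_prefix.
  by apply/esym/nth_prefix => //; apply: size_L.
have uniq_L i : uniq (L i) by rewrite (perm_uniq (perm_L i)) iota_uniq.
have mem_L i k : (k \in L i) = (k < size (L i))%N.
  by rewrite (perm_mem (perm_L i)) mem_iota.
have inj_s : injective s.
  move=> k l; set i := (maxn k l).+1.
  have ki : (k < size (L i))%N by apply: leq_trans (size_L i); rewrite ltnS leq_maxl.
  have li : (l < size (L i))%N by apply: leq_trans (size_L i); rewrite ltnS leq_maxr.
  rewrite (sE i k)// (sE i l)// => /eqP.
  by rewrite nth_uniq// => /eqP.
pose r k := index k (L k.+1).
have sr : cancel r s.
  move=> k; have kL : k \in L k.+1 by rewrite mem_L; exact: size_L.
  by rewrite (sE k.+1) ?index_mem// nth_index.
exists s; first by exists r => // k; apply: inj_s; rewrite sr.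
move=> i Y YL; apply: (@eq_from_nth _ 0%N); first by rewrite size_map size_iota.
move=> k; rewrite size_map size_iota => kY.
rewrite (nth_map 0%N) ?size_iota// nth_iota// add0n (sE i).
  exact: nth_prefix.
by apply: leq_trans kY _; exact: size_prefix.
Qed.

Section UnconditionalSeries.
Context {R : realType} {E : normedModType R}.
Implicit Types u : nat -> E.

(* Otherwise disjoint finite sets of indices carrying sums of norm > 1 can be
   made into consecutive runs of a rearrangement, which is then not Cauchy. *)
Lemma unconditionally_cvg_tail u : unconditionally_cvg u ->
  exists n, forall F : seq nat, uniq F -> all (leq n) F ->
    `|\sum_(k <- F) u k| <= 1.
Proof.
move=> uu; apply: contrapT => /forallNP tail.
have {}tail n : exists F : seq nat,
    [/\ uniq F, all (leq n) F & 1 < `|\sum_(k <- F) u k|].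
  have /existsNP[F /not_implyP[uF /not_implyP[nF /negP]]] := tail n.
  by rewrite -ltNge => ?; exists F.
pose initial (L : seq nat) := perm_eq L (iota 0 (size L)).
(* One extension step: [L'] enumerates a longer initial segment, and a block [F] of large sum comes
   right after [L]. *)
pose ext (L L' : seq nat) := initial L -> [/\ initial L', prefix L L',
  (size L < size L')%N & exists F, prefix (L ++ F) L' /\ 1 < `|\sum_(k <- F) u k|].
have extP L : {L' | ext L L'}.
  apply: cid; have [F [uF nF F1]] := tail (size L).
  pose n := size L; pose m := (\max_(k <- F) k).+1.
  (* [G] fills the gaps left by [F], so that [L ++ F ++ G] enumerates an initial segment again. *)
  pose G := [seq k <- iota n m | k \notin F].
  exists (L ++ F ++ G) => iL.
  have FG : perm_eq (F ++ G) (iota n m).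
    apply: uniq_perm; rewrite ?iota_uniq//.
      rewrite cat_uniq uF filter_uniq ?iota_uniq// andbT/=.
      by apply/hasPn => k; rewrite mem_filter => /andP[].
    move=> k; rewrite mem_cat mem_filter mem_iota.
    case kF : (k \in F) => //=; apply/esym/andP; split.
      exact: (allP nF).
    rewrite addnS ltnS (leq_trans _ (leq_addl _ _))//.
    exact: (@leq_bigmax_seq _ F xpredT id k).
  have sFG : size (F ++ G) = m by rewrite (perm_size FG) size_iota.
  have F0 : (0 < size F)%N.
    by case: (F) F1 => //; rewrite big_nil normr0 ltr10.
  split.
  - by rewrite /initial size_cat sFG iotaD perm_cat.
  - exact: prefix_prefix.
  - by rewrite !size_cat -[ltnLHS]addn0 ltn_add2l addn_gt0 F0.
  - by exists F; rewrite catA prefix_prefix.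
have [L [L0 LS]] := dependent_choice extP [::].
have iL i : initial (L i).
  by elim: i => [|i /LS[]//]; rewrite L0.
have [||s bij_s sL] := @chain_permutation L.
- by move=> i; case: (LS i (iL i)).
- exact: iL.
(* The partial sums after [L n] and after [L n ++ F] both lie within 1/2 of [l], yet they differ by
   the sum over [F]. *)
have /cvg_ex[l /cvgrPdist_lt/(_ 2^-1)] := uu s bij_s.
rewrite invr_gt0 ltr0n => /(_ isT)[n _ nl].
have seriesE i Y : prefix Y (L i) -> series (u \o s) (size Y) = \sum_(k <- Y) u k.
  move=> /sL sY; rewrite -[in RHS]sY big_map /series/= /index_iota subn0.
  by [].
have size_L i : (i <= size (L i))%N.
  by elim: i => // i IH; apply: leq_ltn_trans IH _; case: (LS i (iL i)).
have [_ _ _ [F [LF]]] := LS n (iL n).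
have LL : prefix (L n) (L n) by exact: prefix_refl.
have nF : (n <= size (L n ++ F))%N.
  by rewrite size_cat (leq_trans (size_L n))// leq_addr.
have := nl _ nF; have := nl _ (size_L n) => /=.
rewrite (seriesE _ _ LF) (seriesE _ _ LL) big_cat/=.
set a := \sum_(_ <- _) _; set b := \sum_(_ <- _) _ => h1 h2.
rewrite ltNge => /negP; apply.
have -> : b = (l - a) - (l - (a + b)).
  by rewrite opprB addrC addrA subrK addrAC subrr add0r.
by apply: le_trans (ler_normB _ _) _; lra.
Qed.

(** Indices from the threshold of [unconditionally_cvg_tail] on contribute at most 1, and the
    finitely many below it at most the sum of their norms. *)
Lemma unconditionally_cvg_bounded u : unconditionally_cvg u ->
  exists M : R, forall N (A : pred nat), `|\sum_(k < N | A k) u k| <= M.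
Proof.
move=> /unconditionally_cvg_tail[n tail].
exists (\sum_(k <- iota 0 n) `|u k| + 1) => N A.
rewrite -(big_mkord A) -big_filter (bigID (fun k => (k < n)%N))/=.
apply: le_trans (ler_normD _ _) _; apply: lerD; rewrite -big_filter.
  set F := [seq _ <- _ | _]; apply: le_trans (ler_norm_sum _ _ _) _.
  have uF : uniq F by rewrite !filter_uniq ?iota_uniq.
  have FE : perm_eq F [seq k <- iota 0 n | k \in F].
    apply: uniq_perm; rewrite ?filter_uniq ?iota_uniq// => k.
    rewrite [in RHS]mem_filter mem_iota/= add0n.
    by rewrite [k \in F]mem_filter; case: (k < n)%N => //; rewrite andbT.
  rewrite (perm_big _ FE) big_filter big_mkcond/=.
  by apply: ler_sum => k _; case: ifP.
apply: tail; first by rewrite !filter_uniq ?iota_uniq.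
by apply/allP => k; rewrite mem_filter -leqNgt => /andP[].
Qed.

End UnconditionalSeries.

(** * Coordinates and finite sections with respect to a Schauder basis *)

Section Coordinates.
Context {R : realType} {E : normedModType R} {x : nat -> E}.
Variable hx : schauder_basis x.
Implicit Types (u v : E) (a : nat -> R).

Definition basis_coord v : nat -> R := sval (cid (hx v)).

Lemma basis_coord_cvg v : series (fun k => basis_coord v k *: x k) @ \oo --> v.
Proof. by rewrite /basis_coord; case: cid => a []. Qed.

Lemma basis_coord_unique v a : series (fun k => a k *: x k) @ \oo --> v -> basis_coord v = a.
Proof. by rewrite /basis_coord; case: cid => b [/= _]; apply. Qed.

Lemma basis_coordD u v k : basis_coord (u + v) k = basis_coord u k + basis_coord v k.
Proof.
rewrite (@basis_coord_unique _ (fun k => basis_coord u k + basis_coord v k))//.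
have -> : (fun k => (basis_coord u k + basis_coord v k) *: x k) =
    (fun k => basis_coord u k *: x k) + (fun k => basis_coord v k *: x k).
  by apply/funext => j; rewrite scalerDl.
by rewrite seriesD; apply: cvgD; exact: basis_coord_cvg.
Qed.

Lemma basis_coordZ (c : R) v k : basis_coord (c *: v) k = c * basis_coord v k.
Proof.
rewrite (@basis_coord_unique _ (fun k => c * basis_coord v k))//.
have -> : (fun k => (c * basis_coord v k) *: x k) = c *: (fun k => basis_coord v k *: x k).
  by apply/funext => j; rewrite -scalerA.
by rewrite seriesZ; apply: cvgZr; exact: basis_coord_cvg.
Qed.

Lemma basis_coordB u v k : basis_coord (u - v) k = basis_coord u k - basis_coord v k.
Proof. by rewrite -scaleN1r basis_coordD basis_coordZ mulN1r. Qed.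

Lemma basis_coord0 k : basis_coord 0 k = 0.
Proof. by rewrite -(scale0r (0 : E)) basis_coordZ mul0r. Qed.

Lemma basis_coord_sum n a j : (j < n)%N -> basis_coord (\sum_(k < n) a k *: x k) j = a j.
Proof.
move=> jn; rewrite (@basis_coord_unique _ (fun k => if (k < n)%N then a k else 0)) ?jn//.
apply: cvg_near_cst; near=> m.
have nm : (n <= m)%N by near: m; exact: nbhs_infty_ge.
rewrite /series/= (big_cat_nat (leq0n n) nm)/= [X in _ + X]big_nat [X in _ + X]big1 ?addr0.
  by rewrite big_mkord; apply: eq_bigr => k _; rewrite ltn_ord.
by move=> k /andP[nk _]; rewrite ltnNge nk scale0r.
Unshelve. all: by end_near. Qed.

(** If [x k] vanished, its coefficient would be arbitrary and 0 would have two expansions. *)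
Lemma basis_neq0 k : x k != 0.
Proof.
apply/eqP => xk0; have := @basis_coord_sum k.+1 (fun j => (j == k)%:R) k (ltnSn k).
rewrite eqxx big1 => [|j _].
  by rewrite basis_coord0 => /eqP; rewrite eq_sym oner_eq0.
by have [->|] := eqVneq (j : nat) k; rewrite ?xk0 ?scaler0 ?scale0r.
Qed.

Definition basis_section N (A : pred nat) v := \sum_(k < N | A k) basis_coord v k *: x k.

Lemma basis_sectionD N A u v :
  basis_section N A (u + v) = basis_section N A u + basis_section N A v.
Proof.
by rewrite -big_split; apply: eq_bigr => k _; rewrite basis_coordD scalerDl.
Qed.

Lemma basis_sectionZ N A (c : R) v :
  basis_section N A (c *: v) = c *: basis_section N A v.
Proof. by rewrite scaler_sumr; apply: eq_bigr => k _; rewrite basis_coordZ scalerA. Qed.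

(** A bound on the unconditional norm of [v], in a form that makes sense before that supremum is
    known to be finite. *)
Definition sections_bounded (M : R) v : Prop :=
  forall N A, `|basis_section N A v| <= M.

Lemma sections_boundedD L M u v :
  sections_bounded L u -> sections_bounded M v -> sections_bounded (L + M) (u + v).
Proof.
by move=> bu bv N A; rewrite basis_sectionD (le_trans (ler_normD _ _))// lerD.
Qed.

Lemma sections_boundedZ M (c : R) v :
  sections_bounded M v -> sections_bounded (`|c| * M) (c *: v).
Proof. by move=> bv N A; rewrite basis_sectionZ normrZ ler_wpM2l. Qed.

Lemma sections_bounded0 : sections_bounded 0 0.
Proof.
by move=> N A; rewrite /basis_section big1 ?normr0// => k _; rewrite basis_coord0 scale0r.
Qed.

Lemma sections_bounded_coord M v k :
  sections_bounded M v -> `|basis_coord v k| * `|x k| <= M.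
Proof.
by move=> /(_ k.+1 (pred1 k)); rewrite /basis_section (big_pred1 ord_max)// normrZ.
Qed.

(* The norm sup over N and A of the sections dominates the norm of E and makes E
   complete: a Cauchy sequence converges coordinatewise, uniformly in the
   sections. *)
Lemma sections_bounded_lim (z : nat -> E) (y : E) (t : nat -> R) :
  z @ \oo --> y -> t @ \oo --> (0 : R) ->
  (forall J L, (J <= L)%N -> sections_bounded (t J) (z L - z J)) ->
  forall J, sections_bounded (t J) (y - z J).
Proof.
move=> zy t0 tz.
pose d k := limn (fun J => basis_coord (z J) k).
have d_cvg k : (fun J => basis_coord (z J) k) @ \oo --> d k.
  apply: cauchy_cvg; apply: cauchy_exP => e e0.
  have xk0 : 0 < `|x k| by rewrite normr_gt0 basis_neq0.
  (* Sections control a coordinate only after multiplication by the norm of [x k], hence this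
     tolerance. *)
  have /cvgrPdist_lt/(_ _ (mulr_gt0 e0 xk0))[J _ tJ] := t0.
  exists (basis_coord (z J) k); exists J => // L /= JL.
  rewrite -ball_normE/= distrC -basis_coordB -(ltr_pM2r xk0).
  apply: le_lt_trans (sections_bounded_coord _ (tz _ _ JL)) _.
  by apply: le_lt_trans (tJ J (leqnn J)); rewrite sub0r normrN ler_norm.
(* [L] tends to infinity in the bound for [z L - z J]; a section is a finite sum, so it converges
   with the coordinates. *)
have dz J N (A : pred nat) :
    `|\sum_(k < N | A k) (d k - basis_coord (z J) k) *: x k| <= t J.
  have : (fun L => `|\sum_(k < N | A k) basis_coord (z L - z J) k *: x k|) @ \oo -->
      `|\sum_(k < N | A k) (d k - basis_coord (z J) k) *: x k|.
    apply: cvg_norm; apply: cvg_big => [|k _]; first exact: add_continuous.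
    apply: cvgZl; under eq_fun do rewrite basis_coordB.
    by apply: cvgB => //; exact: cvg_cst.
  move=> h; rewrite -(cvg_lim _ h)//; apply: limr_le; first by apply/cvg_ex; eexists; exact: h.
  by near=> L; apply: tz; near: L; exact: nbhs_infty_ge.
(* Three-epsilon argument: [z J] is close to [y], its expansion converges to it, and by [dz] the
   partial sums for [d] and for [z J] differ by at most [t J], uniformly in their length. *)
have dE : basis_coord y = d.
  apply: basis_coord_unique; apply/cvgrPdist_lt => e e0.
  have e3 : 0 < e / 3 by rewrite divr_gt0.
  have [J [zJ tJ]] : exists J, `|y - z J| < e / 3 /\ t J < e / 3.
    have /cvgrPdist_lt/(_ _ e3)[J1 _ zJ1] := zy.
    have /cvgrPdist_lt/(_ _ e3)[J2 _ tJ2] := t0.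
    exists (maxn J1 J2); split; first by apply: zJ1 => /=; exact: leq_maxl.
    have /= := tJ2 _ (leq_maxr J1 J2).
    by rewrite sub0r normrN; apply: le_lt_trans; exact: ler_norm.
  have /cvgrPdist_lt/(_ _ e3)[N _ zN] := @basis_coord_cvg (z J).
  exists N => // n /= /zN/= zJn.
  have := dz J n xpredT; rewrite /series/= in zJn *.
  rewrite !big_mkord in zJn *.
  have -> : \sum_(k < n) (d k - basis_coord (z J) k) *: x k =
      \sum_(k < n) d k *: x k - \sum_(k < n) basis_coord (z J) k *: x k.
    by rewrite -sumrB; apply: eq_bigr => k _; rewrite scalerBl.
  set S := \sum_(_ < n) _; set T := \sum_(_ < n) _ in zJn * => ST.
  have -> : y - S = (y - z J) + (z J - T) - (S - T).
    by rewrite addrA subrK opprB addrA subrK.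
  apply: le_lt_trans (ler_normB _ _) _.
  have := ler_normD (y - z J) (z J - T); lra.
move=> J N A; have -> : basis_section N A (y - z J) =
    \sum_(k < N | A k) (d k - basis_coord (z J) k) *: x k.
  by apply: eq_bigr => k _; rewrite basis_coordB dE.
exact: dz.
Unshelve. all: by end_near. Qed.

End Coordinates.

(* Baire, then the successive approximation of the open mapping theorem. *)
Lemma unconditional_sections_bounded (R : realType) (E : completeNormedModType R)
    (x : nat -> E) (hx : schauder_basis x) :
  (forall a, cvgn (series (fun k => a k *: x k)) ->
    unconditionally_cvg (fun k => a k *: x k)) ->
  exists2 U : R, 0 < U & forall v, sections_bounded hx (U * `|v|) v.
Proof.
move=> ux; pose B (n : nat) := [set v | sections_bounded hx n%:R v].
have bounded_nat v : exists n, B n v.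
  have /cvgP/ux/unconditionally_cvg_bounded[M vM] := @basis_coord_cvg _ _ _ hx v.
  exists (Num.bound `|M|) => N A; apply: le_trans (vM N A) _.
  by apply: le_trans (ler_norm M) _; rewrite ltW// archi_boundP.
(* Otherwise the complements of the closures are open and dense, and a point common to all of them
   would lie in no [B n]. *)
have [n [z [r r0 zB]]] : exists n z, exists2 r : R, 0 < r & ball z r `<=` closure (B n).
  apply: contrapT => noball.
  have : dense (\bigcap_n ~` closure (B n)).
    apply: Baire => n; split; first by rewrite openC; exact: closed_closure.
    move=> O [z Oz] oO; apply: contrapT => OB; apply: noball.
    have /nbhs_ballP[r /= r0 rO] : nbhs z O by exact: open_nbhs_nbhs.
    exists n, z, r => // y /rO Oy; apply: contrapT => yB.
    by apply: OB; exists y.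
  move=> /(_ setT); case; [by exists 0 | exact: openT | ].
  move=> v [_ vB]; have [n nv] := bounded_nat v.
  by apply: (vB n) => //; exact: subset_closure.
(* Both [z + y] and [z] are close to points of [B n]; the difference of these points is close to
   [y]. *)
have approx0 y e : 0 < e -> `|y| < r ->
    exists2 w, sections_bounded hx (n%:R + n%:R) w & `|y - w| < e.
  move=> e0 yr; have e2 : 0 < e / 2 by rewrite divr_gt0.
  have [|w1 w1B yw1] := (closure_normP _ _).1 (zB (z + y) _) _ e2.
    by rewrite -ball_normE/= opprD addrA subrr sub0r normrN.
  have [|w2 w2B yw2] := (closure_normP _ _).1 (zB z _) _ e2.
    exact: ballxx.
  exists (w1 - w2).
    apply: sections_boundedD => //.
    by have := sections_boundedZ (-1) w2B; rewrite normrN1 mul1r scaleN1r.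
  have -> : y - (w1 - w2) = (z + y - w1) - (z - w2).
    by rewrite -[z + y - w1]addrA [- (z - w2)]opprD addrACA subrr add0r opprK opprD opprK addrA.
  by apply: le_lt_trans (ler_normB _ _) _; rewrite [ltRHS]splitr ltrD.
(* Rescaling [y] to norm [r / 2] turns the bound [n + n] into [4 n / r] times the norm of [y]. *)
pose M := 4 * n%:R / r.
have approx y e : 0 < e ->
    exists w, sections_bounded hx (M * `|y|) w /\ `|y - w| < e.
  have [->|y0] := eqVneq y 0 => e0.
    by exists 0; rewrite subrr normr0 mulr0; split => //; exact: sections_bounded0.
  have ny0 : 0 < `|y| by rewrite normr_gt0.
  pose c := r / (2 * `|y|); have c0 : 0 < c by rewrite divr_gt0// mulr_gt0.
  have [||w wB yw] := @approx0 (c *: y) (c * e); first by rewrite mulr_gt0.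
    rewrite normrZ gtr0_norm// /c.
    have -> : r / (2 * `|y|) * `|y| = r / 2 by field; rewrite gt_eqF.
    by rewrite ltr_pdivrMr// ltr_pMr// ltr1n.
  exists (c^-1 *: w); split.
    have -> : M * `|y| = `|c^-1| * (n%:R + n%:R).
      rewrite gtr0_norm ?invr_gt0// /M /c; field.
      by rewrite !gt_eqF.
    exact: sections_boundedZ.
  have -> : y - c^-1 *: w = c^-1 *: (c *: y - w).
    by rewrite scalerBr scalerA mulVf ?scale1r// gt_eqF.
  by rewrite normrZ gtr0_norm ?invr_gt0// mulrC ltr_pdivrMr// mulrC.
have M0 : 0 <= M by rewrite divr_ge0 ?(ltW r0)// mulr_ge0.
(* [2 * M] sums the geometric series of corrections; the added 1 keeps [U] positive even if [M] is
   0. *)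
pose U := 2 * M + 1; have U0 : 0 < U by rewrite ltr_wpDl// mulr_ge0.
exists U => // y.
have [->|y0] := eqVneq y 0.
  by rewrite normr0 mulr0; exact: sections_bounded0.
have ny0 : 0 < `|y| by rewrite normr_gt0.
pose h (j : nat) : R := `|y| * 2^-1 ^+ j.
have h0 j : 0 < h j by rewrite mulr_gt0// exprn_gt0.
have hS j : h j = h j.+1 + h j.+1 by rewrite /h exprS; field.
have h_cvg : h @ \oo --> (0 : R).
  rewrite -[X in _ --> X](mulr0 `|y|); apply: cvgMr; apply: cvg_expr.
  by rewrite gtr0_norm// invf_lt1// ltr1n.
have [g gP] := choice (fun je : nat * E => approx je.2 _ (h0 je.1.+1)).
(* [s j] is what remains of [y] after [j] approximations. *)
pose s := fix s (j : nat) : E := if j is i.+1 then s i - g (i, s i) else y.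
have s_le j : `|s j| <= h j.
  case: j => [|j]; first by rewrite /h expr0 mulr1.
  by have [_ /= /ltW] := gP (j, s j).
(* The sum of [M * h i] over [i >= j], which bounds all later corrections together. *)
pose t j := 2 * M * h j.
have step j : sections_bounded hx (M * h j) (s j - s j.+1).
  have [sB _] := gP (j, s j); rewrite /= opprB addrC subrK => N A.
  by apply: le_trans (sB N A) _; rewrite ler_wpM2l ?s_le.
have tz J L : (J <= L)%N -> sections_bounded hx (t J - t L) (s J - s L).
  move=> /subnKC <-; elim: (L - J)%N => [|d IH].
    by rewrite addn0 !subrr; exact: sections_bounded0.
  rewrite addnS; have := sections_boundedD IH (step (J + d)%N).
  rewrite addrA subrK; congr sections_bounded.
  by rewrite /t (hS (J + d)%N); ring.
have t_cvg : t @ \oo --> (0 : R).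
  by rewrite -[X in _ --> X](mulr0 (2 * M)); exact: cvgMr.
have sy : (fun j => y - s j) @ \oo --> y.
  rewrite -[X in _ --> X]subr0; apply: cvgB; first exact: cvg_cst.
  apply/norm_cvg0P; apply: (@squeeze_cvgr _ _ _ _ (cst 0) h) => //; last exact: cvg_cst.
  by apply: nearW => j /=; rewrite normr_ge0 s_le.
have ys_cauchy J L : (J <= L)%N -> sections_bounded hx (t J) ((y - s L) - (y - s J)).
  move=> JL N A; rewrite opprB addrC addrA subrK.
  apply: le_trans (tz _ _ JL N A) _.
  by rewrite gerBl; apply: mulr_ge0; [exact: mulr_ge0 | exact/ltW/h0].
have := sections_bounded_lim sy t_cvg ys_cauchy 0; rewrite /= subrr subr0.
move=> yB N A; apply: le_trans (yB N A) _.
by rewrite /t /h expr0 mulr1 ler_wpM2r// lerDl.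
Qed.

(** * Norming functionals on finite-dimensional spans *)

Section Sublinear.
Context {R : realType} {V : lmodType R}.
Implicit Types (q : V -> R) (u v y : V) (s : seq V).

Definition sublinear q : Prop :=
  (forall u v, q (u + v) <= q u + q v) /\
  (forall (a : R) v, 0 < a -> q (a *: v) = a * q v).

(** For sublinear [q] this means that [q] is linear on the line through [v]. *)
Definition odd_at q v : Prop := q v + q (- v) = 0.

Lemma sublinear0 q : sublinear q -> q 0 = 0.
Proof. by move=> [_ /(_ 2 0 (ltr0Sn _ _))]; rewrite scaler0 => h; lra. Qed.

Lemma sublinear_addN_ge0 q v : sublinear q -> 0 <= q v + q (- v).
Proof. by move=> sq; rewrite -(sublinear0 sq) -(subrr v) sq.1. Qed.

(* The minorant is the infimum over t >= 0 of q (v + t y) - t q y. *)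
Lemma sublinear_odd_minorant1 q y : sublinear q ->
  exists q', [/\ sublinear q', forall v, q' v <= q v & q' (- y) <= - q y].
Proof.
move=> sq; have [qD qZ] := sq.
pose S v := [set q (v + t *: y) - t * q y | t in [set t : R | 0 <= t]].
have qZ0 a v : 0 <= a -> q (a *: v) = a * q v.
  rewrite le_eqVlt => /predU1P[<-|/qZ //].
  by rewrite scale0r mul0r (sublinear0 sq).
(* From [t * q y = q (t *: y) <= q (v + t *: y) + q (- v)]; this makes the infimum finite. *)
have Slb v : lbound (S v) (- q (- v)).
  move=> _ [t /= t0 <-]; rewrite lerBrDr -qZ0// addrC -lerBrDr opprK.
  by apply: le_trans (qD _ _); rewrite addrC addKr.
have S0 v : S v !=set0 by exists (q (v + 0 *: y) - 0 * q y), 0 => /=.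
have Sinf v : has_inf (S v) by split => //; exists (- q (- v)).
pose q' v := inf (S v).
have q'le v t : 0 <= t -> q' v <= q (v + t *: y) - t * q y.
  by move=> t0; apply: ge_inf; [case: (Sinf v)| exists t].
exists q'; split.
- split => [u v|a v a0].
    apply/ler_addgt0Pr => e e0; have e2 : 0 < e / 2 by rewrite divr_gt0.
    have [_ [t /= t0 <-] ut] := inf_adherent e2 (Sinf u).
    have [_ [r /= r0 <-] vr] := inf_adherent e2 (Sinf v).
    have := q'le (u + v) (t + r) (addr_ge0 t0 r0).
    have := qD (u + t *: y) (v + r *: y).
    rewrite addrACA -scalerDl => h1 h2.
    move: ut vr; rewrite -!/(q' _); nra.
  have le b w : 0 < b -> q' (b *: w) <= b * q' w.
    move=> b0; rewrite -ler_pdivrMl//; apply: lb_le_inf => // _ [t /= t0 <-].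
    rewrite ler_pdivrMl//.
    have := q'le (b *: w) (b * t) (mulr_ge0 (ltW b0) t0).
    by rewrite -scalerA -scalerDr qZ//; nra.
  apply/eqP; rewrite eq_le le//=.
  have := le a^-1 (a *: v); rewrite invr_gt0 => /(_ a0).
  by rewrite scalerA mulVf ?gt_eqF// scale1r ler_pdivlMl.
- by move=> v; have := q'le v 0 (lexx 0); rewrite scale0r addr0 mul0r subr0.
- have := q'le (- y) 1 ler01.
  by rewrite scale1r addNr (sublinear0 sq) mul1r sub0r.
Qed.

(** The bounds at [y] and [- y] that force oddness persist for every smaller sublinear function, so
    vectors already treated stay odd while the others are handled. *)
Lemma sublinear_odd_minorant q s : sublinear q ->
  exists q', [/\ sublinear q', forall v, q' v <= q v &
    forall y, y \in s -> odd_at q' y].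
Proof.
elim: s q => [|y s IH] q sq; first by exists q.
have [q1 [sq1 q1q q1y]] := sublinear_odd_minorant1 y sq.
have [q2 [sq2 q2q1 q2s]] := IH _ sq1.
exists q2; split=> // [v|z]; first exact: le_trans (q1q v).
rewrite in_cons => /predU1P[->|/q2s//].
apply/eqP; rewrite eq_le (sublinear_addN_ge0 _ sq2) andbT.
have := q2q1 y; have := q2q1 (- y); have := q1q y; lra.
Qed.

(** The subadditivity bounds at [u + v] and at its opposite add up to 0, while the two values have a
    nonnegative sum; so both bounds are equalities. *)
Lemma odd_atD q u v : sublinear q -> odd_at q u -> odd_at q v ->
  odd_at q (u + v) /\ q (u + v) = q u + q v.
Proof.
rewrite /odd_at => sq ou ov; have := sq.1 u v; have := sq.1 (- u) (- v).
by have := sublinear_addN_ge0 (u + v) sq; rewrite opprD; split; lra.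
Qed.

Lemma odd_atZ q (a : R) v : sublinear q -> odd_at q v ->
  odd_at q (a *: v) /\ q (a *: v) = a * q v.
Proof.
rewrite /odd_at => sq ov; have [a0|a0|->] := ltrgtP a 0.
- have na0 : 0 < - a by rewrite oppr_gt0.
  rewrite -scaleNr -[a *: v]opprK -scaleNr -scalerN !(sq.2)//.
  by split; nra.
- by rewrite -scalerN !(sq.2)//; split; nra.
- by rewrite scale0r oppr0 (sublinear0 sq); split; lra.
Qed.

Lemma odd_at_sum q n (a : nat -> R) (x : nat -> V) (P : pred 'I_n) :
  sublinear q -> (forall k, (k < n)%N -> odd_at q (x k)) ->
  q (\sum_(k < n | P k) a k *: x k) = \sum_(k < n | P k) a k * q (x k).
Proof.
move=> sq ox.
suff [] : odd_at q (\sum_(k < n | P k) a k *: x k) /\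
  q (\sum_(k < n | P k) a k *: x k) = \sum_(k < n | P k) a k * q (x k) by [].
elim/big_rec2 : _ => [|k r v _ [ov vr]].
  by rewrite /odd_at oppr0 (sublinear0 sq) addr0.
have [oa aE] := odd_atZ (a k) sq (ox k (ltn_ord k)).
by have [? ->] := odd_atD sq oa ov; rewrite aE vr.
Qed.

End Sublinear.

(* Hahn-Banach on the span of finitely many vectors. *)
Lemma norming_functional (R : realType) (V : normedModType R) n
    (a : nat -> R) (x : nat -> V) :
  exists w : nat -> R,
    \sum_(k < n) a k * w k = `|\sum_(k < n) a k *: x k| /\
    forall (b : nat -> R) (P : pred 'I_n),
      \sum_(k < n | P k) b k * w k <= `|\sum_(k < n | P k) b k *: x k|.
Proof.
set v := \sum_(k < n) a k *: x k.
have sn : sublinear (fun v : V => `|v|).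
  by split=> [|c u c0]; [exact: ler_normD | rewrite normrZ gtr0_norm].
(* [q1] is pushed down at [- v], which forces every smaller sublinear function to reach the norm at
   [v]. Oddness at each [x k] then gives linearity on the span. *)
have [q1 [sq1 q1q q1v]] := sublinear_odd_minorant1 v sn.
have [q [sq qq1 qo]] := sublinear_odd_minorant [seq x k | k <- iota 0 n] sq1.
have ox k : (k < n)%N -> odd_at q (x k).
  by move=> kn; apply: qo; apply/mapP; exists k => //; rewrite mem_iota.
exists (fun k => q (x k)); split=> [|b P]; last first.
  by rewrite -(odd_at_sum b P sq ox); exact: le_trans (qq1 _) (q1q _).
rewrite -(odd_at_sum a xpredT sq ox).
apply/eqP; rewrite eq_le (le_trans (qq1 _) (q1q _))//=.
by have := qq1 (- v); have := sublinear_addN_ge0 v sq; rewrite -/v; lra.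
Qed.

(** * Khintchine's inequality *)

Section Rademacher.
Context {R : realType}.
Implicit Types (p t y : R).

(** A weak form of cosh t <= exp (t^2 / 2). For small t, the left side is at most 1/(1-t) + 1/(1+t)
    = 2/(1-t^2); for large t, |t| <= 2 t^2. *)
Lemma expR_addN_le t : expR t + expR (- t) <= 2 * expR (2 * t ^+ 2).
Proof.
have [t_small|t_large] := leP (t ^+ 2) 2^-1.
  have inv_le (s : R) : s < 1 -> expR s <= (1 - s)^-1.
    move=> s1; rewrite -[s in expR s]opprK expRN lef_pV2 ?posrE ?expR_gt0 ?subr_gt0//.
    exact: expR_ge1Dx.
  have t1 : t < 1 by rewrite ltNge; apply/negP => t1; nra.
  have t1' : - t < 1 by rewrite ltNge; apply/negP => t1'; nra.
  have t21 : 0 < 1 - t ^+ 2 by lra.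
  apply: (@le_trans _ _ (2 * (1 + 2 * t ^+ 2))); last first.
    by rewrite ler_pM2l// expR_ge1Dx.
  apply: (le_trans (lerD (inv_le _ t1) (inv_le _ t1'))).
  have -> : (1 - t)^-1 + (1 - - t)^-1 = 2 / (1 - t ^+ 2).
    field; rewrite opprK; apply/and3P; split; apply/eqP; nra.
  rewrite ler_pM2l// -[leLHS]mul1r ler_pdivrMr//; nra.
have le2 (s : R) : s ^+ 2 = t ^+ 2 -> expR s <= expR (2 * t ^+ 2).
  move=> st; rewrite ler_expR -st; move: t_large; rewrite -st.
  by have [|] := leP s 2^-1; nra.
by rewrite mulrDl mul1r lerD ?le2 ?sqrrN.
Qed.

Lemma powR_le_expR p y : 1 <= p -> 0 <= y -> y `^ p <= p `^ p * expR y.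
Proof.
move=> p1 y0; have p0 : 0 < p by lra.
have -> : expR y = (expR (y / p)) `^ p by rewrite -expRM divfK ?gt_eqF.
rewrite -powRM ?expR_ge0 ?(ltW p0)//.
rewrite ge0_ler_powR ?nnegrE ?mulr_ge0 ?expR_ge0 ?(ltW p0)//.
rewrite mulrC -ler_pdivrMr// (le_trans _ (expR_ge1Dx _))//.
by rewrite lerDr.
Qed.

(** Independence of the signs: the sum over sign patterns factors into a product over
    coordinates. *)
Lemma rademacher_expR n (t : 'I_n -> R) :
  \sum_(f : {ffun 'I_n -> bool}) expR (\sum_k (-1) ^+ f k * t k) <=
    2 ^+ n * expR (2 * \sum_k t k ^+ 2).
Proof.
under eq_bigr do rewrite expR_sum.
rewrite -(bigA_distr_bigA (fun k (b : bool) => expR ((-1) ^+ b * t k))).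
have -> : 2 ^+ n = \prod_(k < n) 2 :> R by rewrite prodr_const card_ord.
rewrite mulr_sumr expR_sum -big_split/=.
apply: ler_prod => k _; rewrite big_bool/= expr1 expr0 mulN1r mul1r addrC.
by rewrite expR_addN_le addr_ge0 ?expR_ge0.
Qed.

(** The upper Khintchine inequality, summed over the 2^n sign patterns instead of averaged. After
    scaling to [D = 1], the power is dominated by an exponential and exp |S| <= exp S + exp (-S). *)
Lemma rademacher_powR p n (t : 'I_n -> R) (D : R) : 1 <= p -> 0 < D ->
  \sum_k t k ^+ 2 <= D ^+ 2 ->
  \sum_(f : {ffun 'I_n -> bool}) `|\sum_k (-1) ^+ f k * t k| `^ p <=
    2 ^+ n * (2 * p `^ p * expR 2) * D `^ p.
Proof.
move=> p1 D0 tD; pose s k := t k / D.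
have s1 : \sum_k s k ^+ 2 <= 1.
  under eq_bigr do rewrite /s expr_div_n.
  by rewrite -mulr_suml ler_pdivrMr ?exprn_gt0// mul1r.
have tE (f : {ffun 'I_n -> bool}) :
    `|\sum_k (-1) ^+ f k * t k| = `|\sum_k (-1) ^+ f k * s k| * D.
  rewrite -[in RHS](gtr0_norm D0) -normrM mulr_suml; congr `|_|.
  by apply: eq_bigr => k _; rewrite -mulrA divfK ?gt_eqF.
under eq_bigr do rewrite tE powRM ?(ltW D0)//.
rewrite -mulr_suml ler_wpM2r ?powR_ge0//.
pose S (f : {ffun 'I_n -> bool}) := \sum_k (-1) ^+ f k * s k.
apply: (@le_trans _ _ (\sum_f p `^ p * (expR (S f) + expR (- S f)))).
  apply: ler_sum => f _; apply: le_trans (powR_le_expR p1 (normr_ge0 _)) _.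
  rewrite ler_wpM2l ?powR_ge0//.
  by case: (ger0P (S f)) => _; rewrite (lerDl, lerDr) expR_ge0.
rewrite -mulr_sumr big_split/= -[2 * _ * _]mulrA [leRHS]mulrCA mulrA.
have -> : 2 * 2 ^+ n * (p `^ p * expR 2) = p `^ p * (2 ^+ n * expR 2 + 2 ^+ n * expR 2) :> R by ring.
rewrite ler_wpM2l ?powR_ge0//.
have le2 (u : 'I_n -> R) : \sum_k u k ^+ 2 <= 1 ->
    \sum_(f : {ffun 'I_n -> bool}) expR (\sum_k (-1) ^+ f k * u k) <= 2 ^+ n * expR 2.
  move=> u1; apply: le_trans (rademacher_expR u) _.
  by rewrite ler_pM2l ?exprn_gt0// ler_expR -[leRHS]mulr1 ler_pM2l.
apply: lerD; first exact: le2.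
have s1' : \sum_k (- s k) ^+ 2 <= 1 by under eq_bigr do rewrite sqrrN.
apply: le_trans (le2 _ s1'); apply: ler_sum => f _.
by rewrite ler_expR /S -sumrN; apply: ler_sum => k _; rewrite mulrN.
Qed.

End Rademacher.

(** * Sums of moduli in the free Banach lattice *)

Section CoordinateFunctionals.
Context {R : realType} {E : normedModType R} {x : nat -> E}.
Variable hx : schauder_basis x.

Lemma coord_basis j k : basis_coord hx (x k) j = (j == k)%:R.
Proof.
have -> : x k = \sum_(i < (maxn j k).+1) (i == k :> nat)%:R *: x i.
  have km : (k < (maxn j k).+1)%N by rewrite ltnS leq_maxr.
  rewrite (bigD1 (Ordinal km))//= eqxx scale1r big1 ?addr0// => i.
  by rewrite -val_eqE/= => /negbTE ->; rewrite scale0r.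
by rewrite (basis_coord_sum hx (fun i => (i == k)%:R))// ltnS leq_maxl.
Qed.

Variable C : R.
Hypothesis coord_le : forall v k, `|basis_coord hx v k| <= C * `|v|.

Lemma coord_continuous k : continuous (basis_coord hx ^~ k).
Proof.
move=> v; apply/cvgrPdist_lt => e e0; near=> u.
rewrite -basis_coordB; apply: le_lt_trans (coord_le _ _) _.
have C1 : C < `|C| + 1 by rewrite ltr_pwDr// ler_norm.
have C0 : 0 < `|C| + 1 by rewrite ltr_wpDl.
apply: (@le_lt_trans _ _ ((`|C| + 1) * `|v - u|)).
  by rewrite ler_wpM2r// ltW.
rewrite mulrC -ltr_pdivlMr//; near: u.
by apply: cvgr_dist_lt => //; rewrite divr_gt0.
Unshelve. all: by end_near. Qed.

Definition coord_comb n (b : 'I_n -> R) (v : E) : R := \sum_k b k * basis_coord hx v k.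

Lemma coord_comb_dual n (b : 'I_n -> R) : coord_comb b \in dual_pred.
Proof.
apply/asboolP; split.
  move=> a u v; rewrite /coord_comb scaler_sumr -big_split/=.
  by apply: eq_bigr => k _; rewrite basis_coordD basis_coordZ mulrDr mulrCA.
move=> v; apply: cvg_big => [|k _]; first exact: add_continuous.
by apply: cvgMr; exact: coord_continuous.
Qed.

End CoordinateFunctionals.

(** The [p]-th root of the constant in [rademacher_powR], without the number of sign patterns. *)
Definition rademacher_const (R : realType) (p : R) : R := (2 * p `^ p * expR 2) `^ p^-1.

Lemma absdelta_sumE (R : realType) (E : normedModType R) (p : R) (p1 : 1 <= p)
    (x : nat -> E) n (a : nat -> R) (x' : dual E) :
  (\sum_(k < n) a k *: absdelta p1 (x k)) x' = \sum_(k < n) a k * `|x' (x k)|.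
Proof.
elim: n => [|n IH]; first by rewrite !big_ord0.
by rewrite !big_ord_recr -IH.
Qed.

Lemma ell2_sumE (R : realType) n (a : nat -> R) j :
  (\sum_(k < n) a k *: ell2_unit R k) j = if (j < n)%N then a j else 0.
Proof.
elim: n => [|n IH]; first by rewrite big_ord0.
rewrite big_ord_recr [LHS]/= -[LHS]/((\sum_(k < n) a k *: ell2_unit R k) j + a n * (j == n)%:R).
rewrite IH ltnS; case: (ltngtP j n) => [||->]; by rewrite ?mulr0 ?mulr1 ?addr0 ?add0r.
Qed.

Lemma c0_sumE (R : realType) n (a : nat -> R) j :
  (\sum_(k < n) a k *: c0_unit R k) j = if (j < n)%N then a j else 0.
Proof.
elim: n => [|n IH]; first by rewrite big_ord0.
rewrite big_ord_recr [LHS]/= -[LHS]/((\sum_(k < n) a k *: c0_unit R k) j + a n * (j == n)%:R).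
rewrite IH ltnS; case: (ltngtP j n) => [||->]; by rewrite ?mulr0 ?mulr1 ?addr0 ?add0r.
Qed.

Lemma ell2_norm_sum (R : realType) n (a : nat -> R) :
  `|\sum_(k < n) a k *: ell2_unit R k| = Num.sqrt (\sum_(k < n) a k ^+ 2).
Proof.
rewrite -[LHS]/(ell2_norm _) /ell2_norm; congr Num.sqrt; apply/cvg_lim => //.
apply: cvg_near_cst; near=> m.
have nm : (n <= m)%N by near: m; exact: nbhs_infty_ge.
rewrite /series/= (big_cat_nat (leq0n n) nm)/= [X in _ + X]big_nat [X in _ + X]big1 ?addr0.
  by rewrite big_mkord; apply: eq_bigr => k _; rewrite ell2_sumE ltn_ord.
by move=> k /andP[nk _]; rewrite ell2_sumE ltnNge nk expr0n.
Unshelve. all: by end_near. Qed.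

(* Tests the norm against the functionals sum_k +-b_k x_k^* for all choices of
   signs. *)
Lemma absdelta_sum_norm_ge (R : realType) (E : normedModType R) (x : nat -> E)
    (hx : schauder_basis x) (C : R) (p : R) (p1 : 1 <= p) n (b : nat -> R) (D : R) :
  (forall v k, `|basis_coord hx v k| <= C * `|v|) -> 0 < D -> (forall k, 0 <= b k) ->
  (forall v, `|v| <= 1 -> \sum_(k < n) (b k * basis_coord hx v k) ^+ 2 <= D ^+ 2) ->
  \sum_(k < n) b k ^+ 2 <=
    rademacher_const p * D * `|\sum_(k < n) b k *: absdelta p1 (x k)|.
Proof.
move=> coord_le D0 b0 bD; have p0 : 0 < p by exact: lt_le_trans p1.
pose T := {ffun 'I_n -> bool}; pose cR : R := 2 * p `^ p * expR 2.
have cR0 : 0 < cR by rewrite !mulr_gt0 ?powR_gt0 ?expR_gt0.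
(* [W] is the Khintchine bound for the signed sums; scaling by [c], with [p]-th power [W^-1], puts
   the functionals into the weak unit ball. *)
pose W := 2 ^+ n * cR * D `^ p.
have W0 : 0 < W by rewrite !mulr_gt0 ?powR_gt0 ?exprn_gt0.
pose c := W `^ (- p^-1).
have c0 : 0 < c by rewrite powR_gt0.
have cp : c `^ p = W^-1 by rewrite -powRrM mulNr mulVf ?gt_eqF// powR_inv1// ltW.
pose xf (f : T) : dual E :=
  Dual (coord_comb_dual coord_le (fun k : 'I_n => c * ((-1) ^+ f k * b k))).
have xfE f v : xf f v = c * \sum_k (-1) ^+ f k * (b k * basis_coord hx v k).
  by rewrite mulr_sumr; apply: eq_bigr => k _; rewrite !mulrA.
pose xs (i : 'I_#|T|) := xf (enum_val i).
have sum_xs (F : T -> R) : \sum_(i < #|T|) F (enum_val i) = \sum_f F f.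
  by rewrite -(big_enum_val F); apply: eq_bigl.
have ball_xs : weak_lp_ball p xs.
  apply: ge_ereal_sup => _ [v /= v1 <-]; rewrite lee_fin.
  rewrite (sum_xs (fun f => `|xf f v| `^ p)).
  under eq_bigr do rewrite xfE normrM (gtr0_norm c0) powRM ?(ltW c0)// cp.
  rewrite -mulr_sumr ler_pdivrMl// mulr1.
  by apply: rademacher_powR => //; exact: bD.
set g := \sum_(k < n) b k *: _; pose S := \sum_(k < n) b k ^+ 2.
have S0 : 0 <= S by apply: sumr_ge0 => k _; exact: sqr_ge0.
(* The modulus removes the signs, so [g] takes the same value at all test functionals. *)
have gE f : g (xf f) = c * S.
  rewrite absdelta_sumE mulr_sumr; apply: eq_bigr => k _.
  rewrite xfE (bigD1 k)//= coord_basis eqxx mulr1 big1 ?addr0 => [|i ik].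
    by rewrite !normrM normr_sign mul1r (gtr0_norm c0) (ger0_norm (b0 k)) mulrCA expr2.
  by rewrite coord_basis val_eqE (negbTE ik) !mulr0.
have g_le : (FBLnorm p (g : dual E -> R) <= `|g|%:E)%E by rewrite -FBL_normE.
have := FBLnorm_sum_le p1 (normr_ge0 g) g_le ball_xs.
rewrite (sum_xs (fun f => `|g (xf f)| `^ p)).
under eq_bigr do rewrite gE ger0_norm ?mulr_ge0 ?(ltW c0)// powRM ?(ltW c0)// cp.
rewrite sumr_const card_ffun card_bool card_ord -mulr_natl natrX mulrA /W.
(* The number of sign patterns cancels, leaving a constant independent of [n]. *)
have -> : 2 ^+ n * (2 ^+ n * cR * D `^ p)^-1 = (cR * D `^ p)^-1 :> R.
  by field; rewrite !gt_eqF ?powR_gt0 ?exprn_gt0.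
rewrite ler_pdivrMl ?mulr_gt0 ?powR_gt0// => gS.
rewrite -/S leNgt; apply/negP => Slt.
have := gt0_ltr_powR p0 _ _ Slt; rewrite !nnegrE.
rewrite !mulr_ge0 ?powR_ge0 ?(ltW D0)//= => /(_ isT S0).
rewrite !powRM ?mulr_ge0 ?powR_ge0 ?(ltW D0)// -powRrM mulVf ?gt_eqF// powRr1 ?(ltW cR0)//.
by rewrite ltNge gS.
Qed.

Theorem theorem6p17 (R : realType) (E : completeNormedModType R)
    (x : nat -> E) (hx : unconditional_basis x)
    (p : R) (p1 : 1 <= p)
    (hp : equivalent_seq (fun k => absdelta p1 (x k)) (ell2_unit R)) :
  equivalent_seq x (c0_unit R).
Proof.
have [sx ux] := hx; have [K K1 hK] := hp.
have K0 : 0 < K by exact: lt_le_trans K1.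
have [U U0 bU] := @unconditional_sections_bounded _ _ _ sx ux.
(* The lower 2-estimate applied to a single basis vector. *)
have normx k : 1 <= K * `|x k|.
  pose e j : R := (j == k)%:R.
  have := hK k.+1 e; rewrite (ell2_norm_sum k.+1 e).
  have sum1 (V : lmodType R) (y : nat -> V) : \sum_(j < k.+1) e j *: y j = y k.
    rewrite (bigD1 ord_max)//= /e eqxx scale1r big1 ?addr0// => i.
    by rewrite -val_eqE/= => /negbTE ->; rewrite scale0r.
  rewrite (sum1 _ (fun j => absdelta p1 (x j))).
  have -> : \sum_(j < k.+1) e j ^+ 2 = 1.
    rewrite -[RHS](sum1 R^o (fun=> 1)); apply: eq_bigr => j _.
    by rewrite /GRing.scale/= mulr1 /e; case: (_ == _); rewrite ?expr1n ?expr0n.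
  rewrite sqrtr1 => /andP[_ /le_trans]; apply.
  rewrite ler_pM2l// -lee_fin FBL_normE; exact: FBLnorm_absdelta.
pose C := K * U; have C0 : 0 < C by rewrite mulr_gt0.
have coord_le v k : `|basis_coord sx v k| <= C * `|v|.
  have := sections_bounded_coord k (bU v).
  have := normx k; have := normr_ge0 (basis_coord sx v k).
  rewrite /C; set c := `|basis_coord _ _ _|; set t := `|x k|; move=> c0 t1 ct.
  rewrite -mulrA; apply: (@le_trans _ _ (K * (c * t))); last by rewrite ler_pM2l.
  by rewrite mulrCA ler_peMr.
pose D := Num.sqrt (C * (U + U)).
have D0 : 0 < D by rewrite sqrtr_gt0 mulr_gt0// addr_gt0.
pose B := rademacher_const p * D * K.
have B0 : 0 <= B by rewrite !mulr_ge0 ?powR_ge0 ?(ltW D0) ?(ltW K0).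
have upper n (a : nat -> R) : `|\sum_(k < n) a k *: x k| <=
    B ^+ 2 * `|\sum_(k < n) a k *: c0_unit R k|.
  (* [w k] is the value at [x k] of a functional norming the given sum; it remains to bound the sum
     of the absolute values of the [w k], which are the squares of the [b k]. *)
  have [w [<- w_le]] := norming_functional n a x.
  pose b k := Num.sqrt `|w k|.
  have b2 k : b k ^+ 2 = `|w k| by rewrite sqr_sqrtr.
  have wU v : `|v| <= 1 -> \sum_(k < n) `|basis_coord sx v k * w k| <= U + U.
    move=> v1; pose c := basis_coord sx v.
    have section_le (A : pred nat) : `|\sum_(k < n | A k) c k *: x k| <= U.
      by apply: le_trans (bU v n A) _; rewrite ger_pMr.
    pose P k := 0 <= c k * w k.
    (* On the indices of either sign, the sum is, up to sign, the norming functional at a section of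
       [v], hence at most [U]. *)
    rewrite (bigID (fun k : 'I_n => P k))/=; apply: lerD.
      have -> : \sum_(k < n | P k) `|c k * w k| = \sum_(k < n | P k) c k * w k.
        by apply: eq_bigr => k /ger0_norm.
      exact: le_trans (w_le c _) (section_le _).
    have -> : \sum_(k < n | ~~ P k) `|c k * w k| = \sum_(k < n | ~~ P k) (- c k) * w k.
      by apply: eq_bigr => k; rewrite -ltNge => /ltr0_norm ->; rewrite mulNr.
    apply: le_trans (w_le (fun k => - c k) _) _.
    have -> : \sum_(k < n | ~~ P k) (- c k) *: x k = - \sum_(k < n | ~~ P k) c k *: x k.
      by rewrite -sumrN; apply: eq_bigr => k _; rewrite scaleNr.
    by rewrite normrN; exact: (section_le (fun k => ~~ P k)).
  have bD v : `|v| <= 1 -> \sum_(k < n) (b k * basis_coord sx v k) ^+ 2 <= D ^+ 2.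
    move=> v1; rewrite sqr_sqrtr; last by rewrite mulr_ge0 ?addr_ge0 ?(ltW C0) ?(ltW U0).
    apply: (@le_trans _ _ (C * \sum_(k < n) `|basis_coord sx v k * w k|)); last first.
      by rewrite ler_pM2l// wU.
    rewrite mulr_sumr; apply: ler_sum => k _.
    have -> : (b k * basis_coord sx v k) ^+ 2 =
        `|basis_coord sx v k| * `|basis_coord sx v k * w k|.
      by rewrite exprMn b2 -[_ ^+ 2]real_normK ?num_real// normrM; ring.
    rewrite ler_wpM2r//.
    by apply: le_trans (coord_le v k) _; rewrite ger_pMr.
  pose S := \sum_(k < n) `|w k|.
  have S0 : 0 <= S by exact: sumr_ge0.
  have bS : \sum_(k < n) b k ^+ 2 = S by apply: eq_bigr => k _; exact: b2.
  have S_le : S <= B ^+ 2.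
    have b0 k : 0 <= b k by exact: sqrtr_ge0.
    have := absdelta_sum_norm_ge p1 coord_le D0 b0 bD.
    have /andP[+ _] := hK n b; rewrite ell2_norm_sum bS ler_pdivrMl//.
    set N := `|_| => N_le S_leN.
    (* The upper 2-estimate bounds [N] by [K] times the square root of [S]; dividing by that root
       yields the bound on [S]. *)
    have {S_leN} : S <= B * Num.sqrt S.
      apply: le_trans S_leN _; rewrite /B -[leRHS]mulrA ler_wpM2l//.
      by rewrite mulr_ge0 ?powR_ge0 ?(ltW D0).
    have := sqr_sqrtr S0; have := sqrtr_ge0 S; set s := Num.sqrt S => s0 <-.
    have [->|sn0] := eqVneq s 0; first by rewrite expr0n sqr_ge0.
    rewrite expr2 ler_pM2r ?lt_def ?sn0// => sB.
    by rewrite -expr2 lerXn2r ?nnegrE.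
  apply: (@le_trans _ _ (S * `|\sum_(k < n) a k *: c0_unit R k|)); last first.
    by rewrite ler_wpM2r.
  rewrite mulr_suml; apply: ler_sum => k _; rewrite mulrC.
  apply: le_trans (ler_norm _) _; rewrite normrM ler_wpM2l//.
  have := c0_norm_ge (\sum_(k < n) a k *: c0_unit R k) k.
  by rewrite c0_sumE ltn_ord.
have lower n (a : nat -> R) : `|\sum_(k < n) a k *: c0_unit R k| <=
    C * `|\sum_(k < n) a k *: x k|.
  apply: c0_norm_le => j; rewrite c0_sumE; case: ifP => jn.
    by rewrite -[a j](basis_coord_sum sx a jn).
  by rewrite normr0 mulr_ge0 ?(ltW C0).
pose L := 1 + B ^+ 2 + C; have L1 : 1 <= L by rewrite /L -addrA lerDl addr_ge0 ?sqr_ge0 ?(ltW C0).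
exists L => // n a; apply/andP; split.
  rewrite ler_pdivrMl ?(lt_le_trans _ L1)//; apply: le_trans (upper n a) _.
  by rewrite ler_wpM2r// /L addrAC lerDr addr_ge0 ?(ltW C0).
apply: le_trans (lower n a) _.
by rewrite ler_wpM2r// /L lerDr addr_ge0 ?sqr_ge0.
Qed.
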